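(* Let $\mathcal{H}$ be a finite class of hypotheses $h:X\to\{-1,+1\}$ with $|\mathcal{H}|\ge2$, let $D$ be a probability distribution on $X\times\{-1,+1\}$ and let $m\ge1$ be an integer. For any $\delta>0$ (with $16m\ln|\mathcal{H}|\ge\delta^2$, so that the following quantity is defined), set, for each $\eta\ge1$, $$\Delta_\eta=2\sqrt{\frac2m\ln\left(\frac{16m\ln|\mathcal{H}|}{\delta^2}\right)}+\frac{\eta}{m}.$$ Then, with probability at least $1-\delta$ over the random choice of the training set $S\sim D^m$, for all $\eta\ge1$, $$\Pr_{(x,y)\sim D}\left[\hat p_{\eta,\Delta_\eta}(x)\ne0\ \text{ and }\ \hat p_{\eta,\Delta_\eta}(x)\ne\mathrm{sign}(\ell_\eta(x))\right]\le\delta.$$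
   Context: $X$ is a measurable space and all hypotheses are measurable. $S=((x_1,y_1),\dots,(x_m,y_m))$ is a sample of $m$ examples drawn independently from $D$. For $h\in\mathcal{H}$, the true error is $\varepsilon(h)=\Pr_{(x,y)\sim D}[h(x)\ne y]$ and the empirical error is $\hat\varepsilon(h)=\frac1m\sum_{i=1}^m \mathbf{1}[h(x_i)\ne y_i]$. For $\eta>0$ and $x\in X$, the true and empirical log ratios are $$\ell_\eta(x)=\frac1\eta\ln\frac{\sum_{h\in\mathcal{H}:h(x)=+1}e^{-\eta\varepsilon(h)}}{\sum_{h\in\mathcal{H}:h(x)=-1}e^{-\eta\varepsilon(h)}},\qquad \hat\ell_\eta(x)=\frac1\eta\ln\frac{\sum_{h\in\mathcal{H}:h(x)=+1}e^{-\eta\hat\varepsilon(h)}}{\sum_{h\in\mathcal{H}:h(x)=-1}e^{-\eta\hat\varepsilon(h)}}.$$ Convention: if all hypotheses agree on $x$, both log ratios equal $+\infty$ (if all predict $+1$) or both equal $-\infty$ (if all predict $-1$). For $\Delta\ge0$, the algorithm's prediction is $\hat p_{\eta,\Delta}(x)=\mathrm{sign}(\hat\ell_\eta(x))$ if $|\hat\ell_\eta(x)|>\Delta$, and $\hat p_{\eta,\Delta}(x)=0$ otherwise. Here $\mathrm{sign}(z)=+1$ for $z>0$, $-1$ for $z<0$, and $\mathrm{sign}(0)$ is any fixed value in $\{-1,0,+1\}$. *)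

(* Defs.v *)
From HB Require Import structures.
From mathcomp Require Import all_boot all_order all_algebra finmap.
From mathcomp Require Import all_classical all_reals all_analysis.
Set Implicit Arguments.
Unset Strict Implicit.
Unset Printing Implicit Defensive.
Import Order.TTheory GRing.Theory Num.Theory.
Local Open Scope classical_set_scope.
Local Open Scope ring_scope.

(* The label set {-1, +1} is represented by bool (discrete sigma-algebra),    *)
(* with true for +1 and false for -1. Predictions live in {-1, 0, +1} : int.  *)

Section product_power.
Context {d : measure_display} {T : measurableType d} {R : realType}.
Variable D : probability T R.

Definition consT n (z : T * n.-tuple T) : n.+1.-tuple T := [tuple of z.1 :: z.2].

Lemma measurable_consT n : measurable_fun [set: T * n.-tuple T] (@consT n).
Proof. exact: (measurable_cons measurable_fst measurable_snd). Qed.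

HB.instance Definition _ n :=
  isMeasurableFun.Build _ _ _ _ (@consT n) (@measurable_consT n).

(* D^n, as a probability measure on n.-tuple T *)
Fixpoint power_probability n : probability (n.-tuple T) R :=
  match n with
  | 0 => dirac [tuple]
  | k.+1 => distribution (D \x power_probability k)%E (@consT k)
  end.

Lemma power_probabilityE n (A : 'I_n -> set T) :
  (forall i, measurable (A i)) ->
  power_probability n [set t | forall i, A i (tnth t i)] =
  (\prod_(i < n) D (A i))%E.
Proof.
elim: n A => [|n IH] A mA /=.
  by rewrite big_ord0 /dirac /= indicE mem_set// => -[].
rewrite /distribution /pushforward /= big_ord_recl.
rewrite (_ : _ @^-1` _ = A ord0 `*`
    [set t | forall i, A (lift ord0 i) (tnth t i)]); last first.
  apply/seteqP; split => -[x t] /= H.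
    split; first exact: (H ord0).
    by move=> i /=; have := H (lift ord0 i); rewrite tnthS.
  move=> i; case: (unliftP ord0 i) => [j ->|->]; last exact: H.1.
  by rewrite tnthS; exact: H.2.
rewrite product_measure1E//; first by congr (_ * _)%E; apply: IH => i; exact: mA.
rewrite (_ : [set t | _] = \bigcap_(i in [set: 'I_n])
    ((fun t : n.-tuple T => tnth t i) @^-1` A (lift ord0 i))); last first.
  by apply/seteqP; split => t /= H; [move=> i _; exact: H|
     move=> i; exact: (H i I)].
apply: fin_bigcap_measurable => // i _; rewrite -[X in measurable X]setTI.
exact: measurable_tnth.
Qed.

End product_power.

Section log_ratio.
Context {d : measure_display} {X : measurableType d} {R : realType}.
Implicit Types (H : {fset X -> bool}) (h : X -> bool) (x : X) (eta Delta : R).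

Definition true_error (D : probability (X * bool)%type R) h : R :=
  fine (D [set z | h z.1 != z.2]).

Definition empirical_error m (S : m.-tuple (X * bool)) h : R :=
  m%:R^-1 * \sum_(i < m) (h (tnth S i).1 != (tnth S i).2)%:R.

(* For nonempty H the first two cases are exclusive, and in the last one      *)
(* numerator and denominator are both positive.                               *)
Definition log_ratio H (err : (X -> bool) -> R) eta x : \bar R :=
  if all (fun h => h x) H then +oo%E
  else if all (fun h => ~~ h x) H then -oo%E
  else (eta^-1 * ln ((\sum_(h <- H | h x) expR (- eta * err h)) /
                     (\sum_(h <- H | ~~ h x) expR (- eta * err h))))%:E.

Definition true_log_ratio H (D : probability (X * bool)%type R) eta x :=
  log_ratio H (true_error D) eta x.

Definition empirical_log_ratio H m (S : m.-tuple (X * bool)) eta x :=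
  log_ratio H (empirical_error S) eta x.

(* s0 is the value given to sign(0) *)
Definition sign (s0 : int) (z : \bar R) : int :=
  if (0 < z)%E then 1 else if (z < 0)%E then -1 else s0.

Definition prediction (s0 : int) H m (S : m.-tuple (X * bool)) eta Delta x
    : int :=
  let l := empirical_log_ratio H S eta x in
  if (Delta%:E < `|l|)%E then sign s0 l else 0.

Definition threshold (N m : nat) (delta eta : R) : R :=
  2 * Num.sqrt (2 / m%:R * ln (16 * m%:R * ln N%:R / delta ^+ 2))
  + eta / m%:R.

Definition wrong_predictions (s0 : int) H (D : probability (X * bool)%type R)
    m (S : m.-tuple (X * bool)) eta Delta : set (X * bool) :=
  [set z | prediction s0 H S eta Delta z.1 <> 0 /\
           prediction s0 H S eta Delta z.1 <>
             sign s0 (true_log_ratio H D eta z.1)].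

End log_ratio.

(* The two sets whose probability is taken in the theorem are measurable:     *)
(* each depends only on finitely many measurable boolean features.            *)
Section measurability.
Context {d : measure_display} {X : measurableType d} {R : realType}.

Lemma measurable_features d' (T : measurableType d') (J : finType)
    (f : J -> T -> bool) (P : set T) :
  (forall i, measurable_fun setT (f i)) ->
  (forall t u, (forall i, f i t = f i u) -> P t -> P u) -> measurable P.
Proof.
move=> mf HP; pose F t := [ffun i => f i t] : {ffun J -> bool}.
rewrite (_ : P = \bigcup_(v in F @` P)
    \bigcap_(i in [set: J]) (f i @^-1` [set v i])); last first.
  apply/seteqP; split => [t Pt|t [_ [u Pu <-]] H].
    by exists (F t); [exists t | move=> i _; rewrite /= /F ffunE].
  by apply: HP Pu => i; have := H i I; rewrite /= /F ffunE.
apply: fin_bigcup_measurable => // v _; apply: fin_bigcap_measurable => // i _.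
by rewrite -[X in measurable X]setTI; exact: mf.
Qed.

Variables (s0 : int) (H : {fset X -> bool}) (D : probability (X * bool)%type R).
Hypothesis mH : forall h, h \in H -> measurable_fun setT h.

Lemma eq_log_ratio (err err' : (X -> bool) -> R) (eta : R) (x x' : X) :
  {in H, forall h, h x = h x'} -> {in H, err =1 err'} ->
  log_ratio H err eta x = log_ratio H err' eta x'.
Proof.
move=> hx he; rewrite /log_ratio.
rewrite (eq_in_all hx).
have hxN : {in H, forall h, ~~ h x = ~~ h x'} by move=> h /hx ->.
rewrite (eq_in_all hxN).
rewrite (big_seq_cond (fun h => h x)) (big_seq_cond (fun h => ~~ h x)).
rewrite (big_seq_cond (fun h => h x')) (big_seq_cond (fun h => ~~ h x')).
do 2 case: ifP => // _.
congr (_ * ln (_ / _))%:E; apply: eq_big => h.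
- by have [/hx ->|] := boolP (h \in H).
- by move=> /andP[/he ->].
- by have [/hx ->|] := boolP (h \in H).
- by move=> /andP[/he ->].
Qed.

Lemma measurable_wrong_predictions m (S : m.-tuple (X * bool)) (eta Delta : R) :
  measurable (wrong_predictions s0 H D S eta Delta).
Proof.
apply: (@measurable_features _ _ H (fun h z => (val h) z.1)) => [h|z z' E].
  by apply: (@measurableT_comp _ _ _ _ _ _ (val h)) => //; exact: mH (valP h).
have E' : {in H, forall h : X -> bool, h z.1 = h z'.1}.
  by move=> h hH; exact: (E [` hH]%fset).
have L err : log_ratio H err eta z.1 = log_ratio H err eta z'.1 :> \bar R.
  exact: eq_log_ratio.
by rewrite /wrong_predictions /= /prediction /empirical_log_ratio /true_log_ratio !L.
Qed.

Lemma measurable_good_samples m (Delta : R -> R) (delta : R) :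
  measurable [set S : m.-tuple (X * bool) | forall eta : R, 1 <= eta ->
    (D (wrong_predictions s0 H D S eta (Delta eta)) <= delta%:E)%E].
Proof.
apply: (@measurable_features _ _ (H * 'I_m)%type
   (fun hi S => (val hi.1) (tnth S hi.2).1 != (tnth S hi.2).2)) => [[h i]|S S' E].
  have mt := @measurable_tnth _ (X * bool)%type m i.
  have mf : measurable_fun setT
      (fun S : m.-tuple (X * bool) => (val h) (tnth S i).1).
    apply: (@measurableT_comp _ _ _ _ _ _ (val h)); first exact: mH (valP h).
    exact: (@measurableT_comp _ _ _ _ _ _ fst).
  have mg : measurable_fun setT (fun S : m.-tuple (X * bool) => (tnth S i).2).
    exact: (@measurableT_comp _ _ _ _ _ _ snd).
  rewrite (_ : (fun S => _) = fun S : m.-tuple (X * bool) =>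
     ((val h) (tnth S i).1 && ~~ (tnth S i).2) ||
     (~~ (val h) (tnth S i).1 && (tnth S i).2)); last first.
    by apply/funext => S /=; case: (val h _); case: (tnth S i).2.
  by apply: measurable_or; apply: measurable_and => //; exact: measurable_neg.
have E' : {in H, empirical_error (R := R) S =1 empirical_error S'}.
  move=> h hH; congr (_ * _); apply: eq_bigr => i _.
  by rewrite (E ([` hH]%fset, i)).
have L (eta : R) x : empirical_log_ratio H S eta x = empirical_log_ratio H S' eta x :> \bar R.
  exact: eq_log_ratio.
have P (eta De : R) x : prediction s0 H S eta De x = prediction s0 H S' eta De x.
  by rewrite /prediction L.
move=> gS eta eta1; apply: le_trans (gS eta eta1).
rewrite le_eqVlt; apply/orP; left; apply/eqP; congr (D _).
rewrite /wrong_predictions; by apply/seteqP; split => z /=; rewrite P.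
Qed.

End measurability.

(* Main.v *)
Require Import Defs.
From HB Require Import structures.
From mathcomp Require Import all_boot all_order all_algebra finmap.
From mathcomp Require Import all_classical all_reals all_analysis.
From mathcomp Require Import measurable_realfun ring lra.
Import Order.TTheory GRing.Theory Num.Theory.
Local Open Scope classical_set_scope.
Local Open Scope ring_scope.

(** Write [R_K(eta) = eta^-1 ln (sum_{h in K} exp (- eta eps(h)))], and
    [Rhat_K(eta)] for the same quantity with empirical errors. At a point [x]
    where both predictions have voters, the log ratio is the difference of
    [R_K(eta)] over the two classes of voters [K = {h | h x = c}], so a wrong
    nonzero prediction forces [|Rhat_K(eta) - R_K(eta)| > Delta / 2] for one of
    them ([wrong_prediction_deviation]). At a unanimous point both log ratios
    are the same infinity and nothing can go wrong.

    For fixed [eta] and [K], let [q] be the Gibbs weights of the true errors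
    on [K] and let [Y_a] be the [q]-average of [exp (a (epshat(h) - eps(h)))].
    Then [Rhat_K - R_K = eta^-1 ln Y_(-eta)]. Comparing exponential means of
    different orders, [Rhat_K - R_K <= t^-1 ln Y_(-t)] for [t >= eta], and
    Jensen's inequality gives [R_K - Rhat_K <= t^-1 ln Y_t] ([soft_max_dist]).
    Since [q] does not depend on the sample, [E Y_a] is an average of moment
    generating functions of binomial deviations, at most [exp (a^2 / 4m)]
    ([empirical_mgf_le]); Markov's inequality with a well chosen [t] bounds
    the probability of a deviation of [lam + eta / 4m] by [exp (- m lam^2)]
    ([soft_max_tail]).

    To treat all [eta >= 1] at once, note that as a function of the temperature
    [eta^-1] both [R_K] and [Rhat_K] are nondecreasing and [ln |K|]-Lipschitz
    ([soft_max_le], [soft_max_ge]). About [4 m ln |H|] equally spaced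
    temperatures in (0, 1] therefore suffice ([temperature_grid]): rounding
    up to the grid costs less than what [Delta_eta] leaves ([grid_error_le]),
    and the union bound over the grid, both classes and both tails stays below
    [delta^2] ([grid_union_bound]).

    Hence for each [x] the probability over [S] that some [eta] errs at [x] is
    at most [delta^2] ([pointwise_bound]). By Tonelli and Markov, the samples
    for which such [x] have mass at least [delta] have probability at most
    [delta] ([fubini_markov]). *)

(** * Exponential moments and exponential means *)

Section exponential_inequalities.
Context {R : realType}.
Implicit Types s t x y p : R.

Lemma nondecreasing_from0 (f df : R -> R) x :
  (forall y, is_derive y (1 : R) f (df y)) -> (forall y, 0 <= y -> 0 <= df y) ->
  0 <= x -> f 0 <= f x.
Proof.
move=> fE df0 x0.
have fd y : derivable f y (1 : R) by case: (fE y).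
apply: (@ger0_derive1_ndecr _ f 0 x) => //.
- move=> y; rewrite in_itv /= => /andP[/ltW y0 _].
  by rewrite derive1E; case: (fE y) => _ ->; exact: df0.
- exact: derivable_within_continuous.
Qed.

(** The quotient of the two sides has derivative of the sign of
    [sinh x - x cosh x], which is nonpositive for [x >= 0] because its own
    derivative is [- x sinh x]. *)
Lemma expRD_expRN_le x : expR x + expR (- x) <= 2 * expR (x ^+ 2 / 2).
Proof.
wlog x0 : x / 0 <= x => [W|].
  have [/W//|/ltW x0] := leP 0 x.
  by rewrite -sqrrN -{1}[x]opprK addrC; apply: W; rewrite oppr_ge0.
have sinh_ge0 y : 0 <= y -> 0 <= expR y - expR (- y).
  by move=> y0; rewrite subr_ge0 ler_expR; lra.
have slope y : 0 <= y -> 0 <= y * (expR y + expR (- y)) - (expR y - expR (- y)).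
  move=> y0.
  pose f z : R := z * (expR z + expR (- z)) - (expR z - expR (- z)).
  have <- : f 0 = 0 by rewrite /f oppr0; ring.
  apply: (@nondecreasing_from0 f (fun z => z * (expR z - expR (- z)))) => // z.
    rewrite /f; apply: is_derive_eq.
    by rewrite /GRing.scale /=; ring.
  by move=> z0; rewrite mulr_ge0// sinh_ge0.
pose f z : R := - (expR (- (z ^+ 2 / 2)) * (expR z + expR (- z))).
have : f 0 <= f x.
  apply: (@nondecreasing_from0 f (fun z => expR (- (z ^+ 2 / 2)) *
      (z * (expR z + expR (- z)) - (expR z - expR (- z))))) => // z.
    rewrite /f; apply: is_derive_eq.
    by rewrite /GRing.scale /=; field.
  by move=> z0; rewrite mulr_ge0 ?expR_ge0//; exact: slope.
rewrite /f !expRN !expr0n /= mul0r !expR0 invr1 => f0.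
rewrite -ler_pdivrMr ?expR_gt0//; lra.
Qed.

(** Symmetrization: by Jensen the moment generating function of the negated
    variable is at least 1, so multiplying by it only helps, and the product is
    that of a difference of two independent copies, which takes the values
    -1, 0, 1 symmetrically. The price is a constant 1/4 in place of the optimal
    1/8 of Hoeffding's lemma. *)
Lemma bernoulli_mgf_le p s : 0 <= p <= 1 ->
  p * expR (s * (1 - p)) + (1 - p) * expR (s * (0 - p)) <= expR (s ^+ 2 / 4).
Proof.
move=> /andP[p0 p1].
set A := (X in X <= _).
pose B := p * expR (- s * (1 - p)) + (1 - p) * expR (- s * (0 - p)).
have B1 : 1 <= B.
  have e1 := expR_ge1Dx (- s * (1 - p)).
  have e2 := expR_ge1Dx (- s * (0 - p)).
  rewrite /B; nra.
have A0 : 0 <= A by rewrite addr_ge0// mulr_ge0 ?expR_ge0//; lra.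
have AB : A * B = p ^+ 2 + (1 - p) ^+ 2 + p * (1 - p) * (expR s + expR (- s)).
  have -> : expR s = expR (s * (1 - p)) * expR (- s * (0 - p)).
    by rewrite -expRD; congr expR; ring.
  have -> : expR (- s) = expR (s * (0 - p)) * expR (- s * (1 - p)).
    by rewrite -expRD; congr expR; ring.
  have E1 : expR (s * (1 - p)) * expR (- s * (1 - p)) = 1.
    by rewrite mulNr expRxMexpNx_1.
  have E2 : expR (s * (0 - p)) * expR (- s * (0 - p)) = 1.
    by rewrite mulNr expRxMexpNx_1.
  rewrite /A /B; move: E1 E2.
  move: (expR (s * (1 - p))) (expR (- s * (1 - p))) => a b.
  move: (expR (s * (0 - p))) (expR (- s * (0 - p))) => c d E1 E2.
  transitivity (p ^+ 2 * (a * b) + (1 - p) ^+ 2 * (c * d) +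
    p * (1 - p) * (a * d + c * b)); first ring.
  by rewrite E1 E2 !mulr1.
apply: (@le_trans _ _ (A * B)); first by rewrite ler_peMr.
have -> : s ^+ 2 / 4 = (s / 2) ^+ 2 / 2 + (s / 2) ^+ 2 / 2 by field.
rewrite AB expRD.
have := expRD_expRN_le (s / 2).
have -> : expR s = expR (s / 2) ^+ 2 by rewrite -expRM_natl; congr expR; field.
have -> : expR (- s) = expR (- (s / 2)) ^+ 2.
  by rewrite -expRM_natl; congr expR; field.
have := expRxMexpNx_1 (s / 2).
have := expR_gt0 (s / 2); have := expR_gt0 (- (s / 2)).
move: (expR (s / 2)) (expR (- (s / 2))) (expR ((s / 2) ^+ 2 / 2)) => a b c.
move=> b0 a0 ab1 abc.
have abc2 : (a + b) ^+ 2 <= 4 * c * c.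
  have -> : 4 * c * c = (2 * c) ^+ 2 by ring.
  by rewrite !expr2 ler_pM//; lra.
have p4 : p * (1 - p) <= 1 / 4 by have := sqr_ge0 (p - 1 / 2); nra.
have ab2 : 2 <= a ^+ 2 + b ^+ 2 by have := sqr_ge0 (a - b); nra.
have -> : p ^+ 2 + (1 - p) ^+ 2 + p * (1 - p) * (a ^+ 2 + b ^+ 2) =
  1 + p * (1 - p) * (a ^+ 2 + b ^+ 2 - 2) by ring.
have : p * (1 - p) * (a ^+ 2 + b ^+ 2 - 2) <= 1 / 4 * (a ^+ 2 + b ^+ 2 - 2).
  by rewrite ler_wpM2r// subr_ge0.
nra.
Qed.

Context {I : Type}.
Implicit Types (r : seq I) (q v : I -> R).

Lemma jensen_expR r q v : (forall i, 0 <= q i) -> \sum_(i <- r) q i = 1 ->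
  expR (\sum_(i <- r) q i * v i) <= \sum_(i <- r) q i * expR (v i).
Proof.
move=> q0 q1; set mu := \sum_(i <- r) q i * v i.
apply: (@le_trans _ _ (\sum_(i <- r) q i * (expR mu * (1 + (v i - mu))))).
  rewrite [leRHS](_ : _ = expR mu * (\sum_(i <- r) q i +
      (\sum_(i <- r) q i * v i - (\sum_(i <- r) q i) * mu))); last first.
    rewrite !mulr_suml -sumrB -big_split /= mulr_sumr.
    by apply: eq_bigr => i _; ring.
  by rewrite q1 -/mu mul1r subrr addr0 mulr1.
apply: ler_sum => i _; rewrite ler_wpM2l//.
have -> : expR (v i) = expR mu * expR (v i - mu) by rewrite -expRD addrC subrK.
by rewrite ler_wpM2l ?expR_ge0// expR_ge1Dx.
Qed.

(** Exponential means increase with their order: after factoring out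
    [exp (s c)], concavity of [z |-> z ^ (s / t)] bounds each term by the
    tangent at 1, and the tangents average to at most 1. *)
Lemma power_mean_expR r q v s t c :
  (forall i, 0 <= q i) -> \sum_(i <- r) q i = 1 -> 0 < s <= t ->
  \sum_(i <- r) q i * expR (t * v i) <= expR (t * c) ->
  \sum_(i <- r) q i * expR (s * v i) <= expR (s * c).
Proof.
move=> q0 q1 /andP[s0 st] H; have t0 : 0 < t by lra.
pose a := s / t.
have a0 : 0 < a by rewrite divr_gt0.
have a1 : a <= 1 by rewrite ler_pdivrMr// mul1r.
(* the tangent line of exp at [a * z], evaluated at [z] and at 0 *)
have concave z : expR (a * z) <= 1 - a + a * expR z.
  have e1 : expR (a * z) * (1 + (z - a * z)) <= expR z.
    have -> : expR z = expR (a * z) * expR (z - a * z).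
      by rewrite -expRD addrC subrK.
    by rewrite ler_wpM2l ?expR_ge0// expR_ge1Dx.
  have e2 : expR (a * z) * (1 - a * z) <= 1.
    by rewrite -[leRHS](expRxMexpNx_1 (a * z)) ler_wpM2l ?expR_ge0// expR_ge1Dx.
  have -> : expR (a * z) = (1 - a) * (expR (a * z) * (1 - a * z)) +
    a * (expR (a * z) * (1 + (z - a * z))) by ring.
  rewrite lerD//; first by rewrite ler_piMr// subr_ge0.
  by rewrite ler_wpM2l// ltW.
have -> : \sum_(i <- r) q i * expR (s * v i) =
    expR (s * c) * \sum_(i <- r) q i * expR (a * (t * (v i - c))).
  rewrite mulr_sumr; apply: eq_bigr => i _; rewrite mulrCA -expRD; congr (_ * expR _).
  by rewrite /a; field; rewrite gt_eqF.
rewrite ler_piMr ?expR_ge0//.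
apply: (@le_trans _ _ (\sum_(i <- r) q i * (1 - a + a * expR (t * (v i - c))))).
  by apply: ler_sum => i _; rewrite ler_wpM2l.
rewrite [leLHS](_ : _ = (1 - a) * \sum_(i <- r) q i +
   a * (expR (- (t * c)) * \sum_(i <- r) q i * expR (t * v i))); last first.
  rewrite !mulr_sumr -big_split /=; apply: eq_bigr => i _.
  by rewrite mulrBr expRD; ring.
rewrite q1 mulr1.
suff : expR (- (t * c)) * \sum_(i <- r) q i * expR (t * v i) <= 1.
  by move=> h; nra.
by rewrite expRN mulrC ler_pdivrMr ?expR_gt0// mul1r.
Qed.

End exponential_inequalities.

(** * The normalized log-sum-exp and its Gibbs weights *)

Section soft_max.
Context {R : realType} {I : eqType}.
Implicit Types (r : seq I) (u v : I -> R) (s t c : R).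

(** With [u] the opposite of an error, the log ratio is the difference of two
    such terms; [s^-1] plays the role of a temperature. *)
Definition soft_max r s u : R := s^-1 * ln (\sum_(i <- r) expR (s * u i)).

Definition gibbs r s u i : R := expR (s * u i) / \sum_(j <- r) expR (s * u j).

Lemma sum_expR_gt0 r u : (0 < size r)%N -> 0 < \sum_(i <- r) expR (u i).
Proof.
case: r => // i r _; rewrite big_cons ltr_pwDl ?expR_gt0//.
by apply: sumr_ge0 => j _; exact: expR_ge0.
Qed.

Lemma gibbs_ge0 r s u i : 0 <= gibbs r s u i.
Proof.
by rewrite divr_ge0 ?expR_ge0// sumr_ge0// => j _; exact: expR_ge0.
Qed.

Lemma sum_gibbs r s u : (0 < size r)%N -> \sum_(i <- r) gibbs r s u i = 1.
Proof.
by move=> r0; rewrite -mulr_suml divff// gt_eqF// sum_expR_gt0.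
Qed.

Lemma expR_soft_max r s u : (0 < size r)%N -> 0 < s ->
  expR (s * soft_max r s u) = \sum_(i <- r) expR (s * u i).
Proof.
by move=> r0 s0; rewrite mulVKf ?gt_eqF// lnK// posrE sum_expR_gt0.
Qed.

Lemma expR_soft_maxB r s u v : (0 < size r)%N -> 0 < s ->
  expR (s * (soft_max r s v - soft_max r s u)) =
  \sum_(i <- r) gibbs r s u i * expR (s * (v i - u i)).
Proof.
move=> r0 s0; rewrite mulrBr expRB !expR_soft_max// mulr_suml.
apply: eq_bigr => i _; rewrite mulrAC -expRD; congr (expR _ / _); ring.
Qed.

(** A deterministic comparison that holds whatever [u] and [v] are. The upper
    deviation is an exponential mean of order [s], dominated by the one of order
    [t]; the lower deviation is at most the plain [gibbs]-average of [u - v],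
    dominated by an exponential mean of any order. The weights in both
    hypotheses do not involve [v], so that Markov's inequality applies to these
    averages when [v] is random and [u] is not. *)
Lemma soft_max_dist r s t c u v : (0 < size r)%N -> 0 < s <= t ->
  \sum_(i <- r) gibbs r s u i * expR (t * (v i - u i)) <= expR (t * c) ->
  \sum_(i <- r) gibbs r s u i * expR (- t * (v i - u i)) <= expR (t * c) ->
  `|soft_max r s v - soft_max r s u| <= c.
Proof.
move=> r0 st up lo; have /andP[s0 s_le_t] := st.
have t0 : 0 < t by lra.
have q0 := gibbs_ge0 r s u; have q1 := sum_gibbs r s u r0.
have W := expR_soft_maxB r s u v r0 s0.
rewrite ler_norml; apply/andP; split.
  have := le_trans (jensen_expR r _ (fun i => - t * (v i - u i)) q0 q1) lo.
  have := jensen_expR r _ (fun i => s * (v i - u i)) q0 q1.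
  rewrite -W.
  under eq_bigr do rewrite mulrCA.
  under [X in _ -> expR X <= _ -> _]eq_bigr do rewrite mulrCA.
  rewrite -!mulr_sumr !ler_expR ler_pM2l// mulNr -mulrN ler_pM2l//; lra.
by rewrite -(ler_pM2l s0) -ler_expR W; exact: power_mean_expR st up.
Qed.

(** The l^p norms of the vector [exp u] decrease with p. *)
Lemma soft_max_le r s s' u : (0 < size r)%N -> 0 < s' <= s ->
  soft_max r s u <= soft_max r s' u.
Proof.
move=> r0 /andP[s'0 ss']; have s0 : 0 < s by lra.
set M := soft_max r s' u.
have sum1 : \sum_(i <- r) expR (s' * (u i - M)) = 1.
  under eq_bigr do rewrite mulrBr expRB.
  by rewrite -mulr_suml -expR_soft_max// divff// gt_eqF// expR_gt0.
have u_le i : i \in r -> u i <= M.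
  move=> ir; rewrite -subr_le0 -(pmulr_rle0 _ s'0) -expR_le1 -sum1.
  rewrite (big_rem i) //= lerDl sumr_ge0// => j _; exact: expR_ge0.
rewrite -(ler_pM2l s0) -ler_expR expR_soft_max//.
rewrite -[leRHS]mul1r -ler_pdivrMr ?expR_gt0// mulr_suml -sum1.
rewrite big_seq [leRHS]big_seq; apply: ler_sum => i /u_le uiM.
by rewrite -expRB -mulrBr ler_expR ler_wnM2r// subr_le0.
Qed.

(** The reverse comparison of l^p norms, with the usual dimension factor: these
    are means of increasing order for the uniform weights. *)
Lemma soft_max_ge r s s' u : (0 < size r)%N -> 0 < s' <= s ->
  soft_max r s' u <= soft_max r s u + ln (size r)%:R * (s'^-1 - s^-1).
Proof.
move=> r0 s's; have /andP[s'0 ss'] := s's; have s0 : 0 < s by lra.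
have N0 : 0 < (size r)%:R :> R by rewrite ltr0n.
have Ni : 0 <= (size r)%:R^-1 :> R by rewrite invr_ge0 ltW.
have sumE (a : R) (w : I -> R) : 0 < a ->
    \sum_(i <- r) (size r)%:R^-1 * expR (a * w i) =
    expR (a * (soft_max r a w - a^-1 * ln (size r)%:R)).
  move=> a0; rewrite mulrBr expRB expR_soft_max// mulVKf ?gt_eqF// lnK ?posrE//.
  by rewrite -mulr_sumr mulrC.
have unif : \sum_(i <- r) (size r)%:R^-1 = 1 :> R.
  rewrite big_const_seq count_predT iter_addr_0 -[LHS]mulr_natr.
  by rewrite mulVf// gt_eqF.
have := @power_mean_expR _ _ r _ u s' s (soft_max r s u - s^-1 * ln (size r)%:R)
  (fun=> Ni) unif s's.
rewrite !sumE// !ler_expR !ler_pM2l// => /(_ (lexx _)); lra.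
Qed.

(** Both soft maxima increase with the temperature by at most the same amount,
    so their distance changes by at most that amount. *)
Lemma soft_max_dist_transfer r s s' c u v : (0 < size r)%N -> 0 < s' <= s ->
  `|soft_max r s' v - soft_max r s' u| <= c ->
  `|soft_max r s v - soft_max r s u| <= c + ln (size r)%:R * (s'^-1 - s^-1).
Proof.
move=> r0 s's; rewrite !ler_norml => /andP[lo up].
have := soft_max_le r s s' u r0 s's; have := soft_max_le r s s' v r0 s's.
have := soft_max_ge r s s' u r0 s's; have := soft_max_ge r s s' v r0 s's.
move=> *; apply/andP; split; lra.
Qed.

End soft_max.

(** The grid is equally spaced in the temperature [s^-1], not in [s]. *)
Definition grid_point (R : realType) (n : nat) (j : 'I_n) : R := n%:R / j.+1%:R.

(** The temperature is rounded up, so that the grid point lies below [s]: error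
    terms proportional to the grid point are then controlled by [s]. *)
Lemma temperature_grid {R : realType} (n : nat) (s : R) : (0 < n)%N -> 1 <= s ->
  exists2 j : 'I_n, 0 < grid_point R n j <= s &
    (grid_point R n j)^-1 - s^-1 <= n%:R^-1.
Proof.
move=> n0 s1; have s0 : 0 < s by lra.
have nR : 0 < n%:R :> R by rewrite ltr0n.
have Pn : n%:R / s <= n%:R by rewrite ler_pdivrMr// ler_peMr// ltW.
have ex : exists k : nat, n%:R / s <= k%:R by exists n.
case: (ex_minnP ex) => -[|j] nj jmin.
  by move: nj; rewrite leNgt divr_gt0.
have jn : (j < n)%N by exact: jmin.
have j_lt : j%:R < n%:R / s.
  by rewrite ltNge; apply/negP => /jmin; rewrite ltnn.
have j0 : 0 < j.+1%:R :> R by rewrite ltr0n.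
exists (Ordinal jn); rewrite /grid_point /=.
  by rewrite divr_gt0//= ler_pdivrMr// mulrC -ler_pdivrMr.
rewrite invf_div lerBlDr -(ler_pM2r nR) mulrDl mulVf ?gt_eqF// divfK ?gt_eqF//.
by rewrite -natr1 addrC lerD2l mulrC ltW.
Qed.

(** * Markov, union and product inequalities *)

Section measure_inequalities.
Local Open Scope ereal_scope.
Context {d : measure_display} {T : measurableType d} {R : realType}.

Lemma ge0_markov (mu : {measure set T -> \bar R}) (f : T -> \bar R) (a : R) :
  measurable_fun setT f -> (forall x, 0 <= f x) -> (0 <= a)%R ->
  a%:E * mu [set x | a%:E <= f x] <= \int[mu]_x f x.
Proof.
move=> mf f0 a0; set A := [set x | _].
have mA : measurable A.
  by rewrite -[A]setTI; exact: emeasurable_fun_c_infty.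
rewrite -integral_cst//.
apply: (@le_trans _ _ (\int[mu]_(x in A) f x)).
  apply: ge0_le_integral => //.
  exact: measurable_funTS.
by apply: ge0_subset_integral.
Qed.

Lemma measure_finite_union_le (P : probability T R) (J : finType) (A : J -> set T)
    (B : set T) (b : R) :
  (forall j, measurable (A j)) -> measurable B -> B `<=` \bigcup_j A j ->
  (forall j, P (A j) <= b%:E) -> P B <= (#|J|%:R * b)%:E.
Proof.
move=> mA mB BA Pb.
apply: (@le_trans _ _ (\sum_(j : J) P (A j))).
  rewrite fsbig_seq ?index_enum_uniq//.
  apply: content_sub_fsum => // x /BA[j _ Ajx].
  by exists j => //=; rewrite mem_index_enum.
apply: (@le_trans _ _ (\sum_(j : J) b%:E)); first exact: lee_sum.
by rewrite sumEFin lee_fin sumr_const mulr_natl.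
Qed.

End measure_inequalities.

Section power.
Local Open Scope ereal_scope.
Context {d : measure_display} {T : measurableType d} {R : realType}.

(** Tonelli, one coordinate at a time: the integral of a product of functions of
    independent coordinates factors. *)
Lemma integral_power_le (D : probability T R) (g : T -> R) (b : R) n :
  measurable_fun setT g -> (forall z, 0 <= g z)%R ->
  \int[D]_z (g z)%:E <= b%:E ->
  \int[power_probability D n]_t (\prod_(i < n) g (tnth t i))%:E <= (b ^+ n)%:E.
Proof.
move=> mg g0 gb.
have b0 : (0 <= b)%R.
  by rewrite -lee_fin (le_trans _ gb)// integral_ge0// => z _; rewrite lee_fin.
have mprod k : measurable_fun setT (fun t : k.-tuple T => \prod_(i < k) g (tnth t i))%R.
  apply: measurable_prod => i _; apply: measurableT_comp => //.
  exact: measurable_tnth.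
have prod0 k (t : k.-tuple T) : (0 <= \prod_(i < k) g (tnth t i))%R.
  by apply: prodr_ge0 => i _.
elim: n => [|n IH].
  rewrite /= integral_dirac//.
    by rewrite diracT mul1e big_ord0.
  by apply/measurable_EFinP; exact: mprod.
rewrite /= /distribution ge0_integral_pushforward//=; last 2 first.
- by apply/measurable_EFinP; exact: mprod.
- by move=> t _; rewrite lee_fin prod0.
rewrite preimage_setT fubini_tonelli1/=; last 2 first.
- apply/measurable_EFinP.
  exact: (measurableT_comp (mprod n.+1) (@measurable_consT _ T n)).
- by move=> z; rewrite lee_fin prod0.
rewrite /fubini_F /=.
under eq_integral => z _.
  under eq_integral => t _.
    rewrite big_ord_recl /= EFinM.
    rewrite (_ : tnth _ ord0 = z)//.
    under eq_bigr => i _ do rewrite tnthS.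
    over.
  rewrite ge0_integralZl//; last first.
  - by rewrite lee_fin.
  - by move=> t _; rewrite lee_fin prod0.
  - by apply/measurable_EFinP; exact: mprod.
  over.
rewrite /= ge0_integralZr//.
- rewrite exprS EFinM lee_pmul//.
  + by apply: integral_ge0 => // z _; rewrite lee_fin.
  + by apply: integral_ge0 => // t _; rewrite lee_fin prod0.
- exact/measurable_EFinP.
- by move=> z _; rewrite lee_fin.
- by apply: integral_ge0 => // t _; rewrite lee_fin prod0.
Qed.

Lemma integral_two_valued (P : probability T R) (l : T -> bool) (F : bool -> R) :
  measurable [set z | l z] -> (forall c, 0 <= F c)%R ->
  \int[P]_z (F (l z))%:E =
  (fine (P [set z | l z]) * F true + (1 - fine (P [set z | l z])) * F false)%:E.
Proof.
set A := [set z | l z] => mA F0.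
have mC : measurable (~` A) by exact: measurableC.
rewrite (eq_integral (fun z => (F true)%:E * (\1_A z)%:E +
    (F false)%:E * (\1_(~` A) z)%:E)); last first.
  move=> z _; rewrite -!EFinM -EFinD; congr EFin; rewrite !indicE in_setC.
  have -> : (z \in A) = l z by apply/idP/idP; rewrite inE.
  by case: (l z); rewrite ?mulr1 ?mulr0 ?addr0 ?add0r.
rewrite ge0_integralD//=; last 4 first.
- by move=> z _; rewrite -EFinM lee_fin mulr_ge0.
- by apply: measurable_funeM; exact/measurable_EFinP.
- by move=> z _; rewrite -EFinM lee_fin mulr_ge0.
- by apply: measurable_funeM; exact/measurable_EFinP.
rewrite !ge0_integralZl//; try by rewrite ?lee_fin.
all: try by [exact/measurable_EFinP | move=> z _; rewrite lee_fin].
rewrite !integral_indic// !setIT [X in (_ + _ * X)%E](probability_setC P mA).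
have PA : P A = (fine (P A))%:E by rewrite fineK// fin_num_measure.
set p := fine (P A) in PA *; 
rewrite [X in (_ * X + _)%E]PA [X in (_ * (_ - X))%E]PA -!EFinB -!EFinM -EFinD.
by congr EFin; ring.
Qed.

End power.

(** If every section in the first variable has mass at most [a^2], then by
    Tonelli the expected mass of the sections in the second variable is at most
    [a^2], and Markov's inequality applies. *)
Lemma fubini_markov {d1 d2 : measure_display} {T1 : measurableType d1}
    {T2 : measurableType d2} {R : realType} (P1 : probability T1 R)
    (P2 : probability T2 R) (A : set (T1 * T2)) (a : R) :
  measurable A -> 0 < a -> (forall x, P2 (xsection A x) <= (a ^+ 2)%:E)%E ->
  (P2 [set y | a%:E <= P1 (ysection A y)] <= a%:E)%E.
Proof.
move=> mA a0 Ax.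
have G : (\int[P2]_y P1 (ysection A y) <= (a ^+ 2)%:E)%E.
  have := indic_fubini_tonelli P1 P2 mA.
  rewrite indic_fubini_tonelli_FE// indic_fubini_tonelli_GE// => <-.
  apply: (@le_trans _ _ (\int[P1]_x (a ^+ 2)%:E)%E).
    apply: ge0_le_integral => //.
    - exact: measurable_fun_xsection.
    - by move=> x _; exact: Ax.
  rewrite [X in (X <= _)%E](integral_cst P1 measurableT (a ^+ 2)%:E).
  by rewrite [X in (_ * X <= _)%E]probability_setT mule1.
have := le_trans (ge0_markov P2 (fun y => P1 (ysection A y)) a
  (measurable_fun_ysection P1 mA) (fun=> measure_ge0 _ _) (ltW a0)) G.
by rewrite -[X in (_ * X <= _)%E]mul1e expr2 EFinM lee_pmul2l ?mul1e// lte_fin.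
Qed.

(** * Deviations of the empirical error *)

Section empirical_mgf.
Context {d : measure_display} {X : measurableType d} {R : realType}.
Variables (D : probability (X * bool)%type R).

Lemma measurable_loss (h : X -> bool) : measurable_fun [set: X] h ->
  measurable [set z : X * bool | h z.1 != z.2].
Proof.
move=> mh; rewrite (_ : [set _ | _] = setT `&`
   (fun z : X * bool => (h z.1 && ~~ z.2) || (~~ h z.1 && z.2)) @^-1` [set true]).
  have mf : measurable_fun setT (fun z : X * bool => h z.1).
    by apply: measurableT_comp.
  apply: (measurable_or (f := fun z : X * bool => h z.1 && ~~ z.2)) => //.
  - by apply: measurable_and => //; exact: measurable_neg.
  - by apply: measurable_and => //; exact: measurable_neg.
by apply/seteqP; split=> -[x y] /=; case: (h x); case: y => //=; case.
Qed.

Lemma true_error_itv h : measurable_fun [set: X] h ->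
  0 <= true_error D h <= 1.
Proof.
move=> mh; have mA := measurable_loss h mh.
by rewrite fine_ge0//= -lee_fin fineK ?fin_num_measure// probability_le1.
Qed.

Lemma empirical_mgf_le m (h : X -> bool) (t : R) : (0 < m)%N ->
  measurable_fun [set: X] h ->
  (\int[power_probability D m]_S
     (expR (t * (empirical_error S h - true_error D h)))%:E <=
   (expR (t ^+ 2 / (4 * m%:R)))%:E)%E.
Proof.
move=> m0 mh; have m0R : 0 < m%:R :> R by rewrite ltr0n.
set p := true_error D h.
pose F (c : bool) : R := expR (t / m%:R * (c%:R - p)).
have E (S : m.-tuple (X * bool)) : expR (t * (empirical_error S h - p)) =
    \prod_(i < m) F (h (tnth S i).1 != (tnth S i).2).
  rewrite -expR_sum /empirical_error; congr expR.
  rewrite -mulr_sumr sumrB sumr_const card_ord -[p *+ m]mulr_natl.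
  by field; rewrite gt_eqF.
under eq_integral do rewrite E.
have -> : expR (t ^+ 2 / (4 * m%:R)) = expR ((t / m%:R) ^+ 2 / 4) ^+ m :> R.
  by rewrite -expRM_natl; congr expR; field; rewrite gt_eqF.
have mA := measurable_loss h mh.
apply: (integral_power_le D (fun z => F (h z.1 != z.2))).
- rewrite (_ : (fun z => _) = fun z : X * bool =>
    if h z.1 != z.2 then F true else F false).
    apply: measurable_fun_ifT => //.
    by apply: (@measurable_fun_bool _ _ _ _ true); rewrite setTI.
  by apply/funext => z; case: ifP.
- by move=> z; exact: expR_ge0.
rewrite integral_two_valued//; last by move=> c; exact: expR_ge0.
by rewrite lee_fin; apply: bernoulli_mgf_le; exact: true_error_itv.
Qed.
End empirical_mgf.

Section tail_bound.
Context {d : measure_display} {X : measurableType d} {R : realType}.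
Variables (D : probability (X * bool)%type R).

Lemma measurable_empirical_error m (h : X -> bool) :
  measurable_fun [set: X] h ->
  measurable_fun setT (fun S : m.-tuple (X * bool) => empirical_error S h : R).
Proof.
move=> mh; apply: measurable_funM => //; apply: measurable_sum => i.
rewrite (_ : (fun _ => _) = (fun z : X * bool => (h z.1 != z.2)%:R : R) \o
   (fun S : m.-tuple (X * bool) => tnth S i))//.
apply: measurableT_comp; last exact: measurable_tnth.
rewrite (_ : (fun z => _) = \1_[set z : X * bool | h z.1 != z.2]).
  by apply: measurable_indic; exact: measurable_loss.
apply/funext => z; rewrite indicE; congr (_%:R); congr nat_of_bool.
by apply/idP/idP; rewrite inE.
Qed.

Definition exp_deviation m (r : seq (X -> bool)) (q : (X -> bool) -> R) (a : R)
    (S : m.-tuple (X * bool)) : R :=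
  \sum_(h <- r) q h * expR (a * (empirical_error S h - true_error D h)).

Lemma measurable_exp_deviation m r q a :
  {in r, forall h, measurable_fun [set: X] h} ->
  measurable_fun setT (@exp_deviation m r q a).
Proof.
move=> mr; rewrite /exp_deviation.
under eq_fun do rewrite big_tnth.
apply: measurable_sum => i; apply: measurable_funM => //.
apply: measurableT_comp => //; apply: measurable_funM => //.
apply: measurable_funB => //; apply: measurable_empirical_error.
by apply: mr; exact: mem_tnth.
Qed.

(** The weights are deterministic, so a single Markov inequality controls the
    average of all the exponential deviations, with a bound that does not grow
    with the number of hypotheses. *)
Lemma exp_deviation_tail m r q a y : (0 < m)%N -> 0 < y ->
  {in r, forall h, measurable_fun [set: X] h} ->
  (forall h, 0 <= q h) -> \sum_(h <- r) q h = 1 ->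
  (power_probability D m [set S | (y <= exp_deviation m r q a S)%R] <=
   (expR (a ^+ 2 / (4 * m%:R)) / y)%:E)%E.
Proof.
move=> m0 y0 mr q0 q1.
have Y0 S : 0 <= exp_deviation m r q a S.
  by apply: sumr_ge0 => h _; rewrite mulr_ge0// expR_ge0.
have mY := measurable_exp_deviation m r q a mr.
suff EY : (\int[power_probability D m]_S (exp_deviation m r q a S)%:E <=
    (expR (a ^+ 2 / (4 * m%:R)))%:E)%E.
  have := ge0_markov (power_probability D m) (fun S => (exp_deviation m r q a S)%:E) y.
  move=> /(_ _ _ (ltW y0)) M.
  rewrite EFinM lee_pdivlMr// muleC; apply: le_trans EY; apply: M.
  - exact/measurable_EFinP.
  - by move=> S; rewrite lee_fin.
rewrite /exp_deviation.
under eq_integral do rewrite -sumEFin big_tnth.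
have mh (i : 'I_(size r)) := mr _ (mem_tnth i (in_tuple r)).
have me (i : 'I_(size r)) : measurable_fun setT (fun S : m.-tuple (X * bool) =>
    (expR (a * (empirical_error S (tnth (in_tuple r) i) -
       true_error D (tnth (in_tuple r) i))))%:E).
  apply/measurable_EFinP; apply: measurableT_comp => //; apply: measurable_funM => //.
  by apply: measurable_funB => //; exact: measurable_empirical_error.
rewrite ge0_integral_sum//; last 2 first.
- by move=> i; under eq_fun do rewrite EFinM; apply: measurable_funeM; exact: me.
- by move=> i S _; rewrite lee_fin mulr_ge0// expR_ge0.
set b := expR _.
rewrite [leRHS](_ : _ =
  (\sum_(i < size r) (q (tnth (in_tuple r) i) * b)%:E)%E); last first.
  by rewrite sumEFin -(big_tnth _ _ r xpredT (fun h => q h * b)) -mulr_suml q1 mul1r.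
apply: lee_sum => i _.
under eq_integral do rewrite EFinM.
rewrite ge0_integralZl//; last by rewrite lee_fin.
  by rewrite EFinM lee_wpmul2l ?lee_fin//; exact: empirical_mgf_le.
Qed.

End tail_bound.

(** * Wrong predictions come from deviations *)

Section voters.
Context {d : measure_display} {X : measurableType d} {R : realType}.
Implicit Types (H : {fset X -> bool}) (x : X) (c : bool).

Definition voters H x c : seq (X -> bool) := [seq h <- H | h x == c].

Lemma size_voters_le H x c : (size (voters H x c) <= #|` H|)%N.
Proof. by rewrite size_filter count_size. Qed.

Lemma voters_sub H x c h : h \in voters H x c -> h \in H.
Proof. by rewrite mem_filter => /andP[]. Qed.

Lemma log_ratio_unanimous H c (err err' : (X -> bool) -> R) eta x :
  voters H x c = [::] -> log_ratio H err eta x = log_ratio H err' eta x /\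
    (log_ratio H err eta x = +oo \/ log_ratio H err eta x = -oo)%E.
Proof.
move=> /eqP; rewrite -[_ == _]negbK -has_filter -all_predC => Hc.
rewrite /log_ratio; case: c Hc => Hc; last first.
  suff -> : all (fun h => h x) H by split=> //; left.
  by apply: sub_all Hc => h /=; case: (h x).
case: ifP => [_|_]; first by split=> //; left.
suff -> : all (fun h => ~~ h x) H by split=> //; right.
by apply: sub_all Hc => h /=; case: (h x).
Qed.

Lemma log_ratioE H (err : (X -> bool) -> R) eta x :
  (forall c, 0 < size (voters H x c))%N ->
  log_ratio H err eta x =
  (soft_max (voters H x true) eta (fun h => - err h) -
   soft_max (voters H x false) eta (fun h => - err h))%:E.
Proof.
move=> vot; have pos c := sum_expR_gt0 _ (fun h => eta * - err h) (vot c).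
rewrite /log_ratio.
have -> : all (fun h => h x) H = false.
  apply/negbTE; have := vot false; rewrite -has_predC size_filter -has_count.
  by apply: sub_has => h /=; case: (h x).
have -> : all (fun h => ~~ h x) H = false.
  apply/negbTE; have := vot true; rewrite -has_predC size_filter -has_count.
  by apply: sub_has => h /=; case: (h x).
rewrite /soft_max -mulrBr -ln_div ?posrE//; congr (_ * ln (_ / _))%:E.
  rewrite big_filter; apply: eq_big => h; first by rewrite eqb_id.
  by rewrite mulNr mulrN.
rewrite big_filter; apply: eq_big => h; first by rewrite eqbF_neg.
by rewrite mulNr mulrN.
Qed.

(** A nonzero prediction means an empirical log ratio of modulus above [2 a],
    and a wrong one that the true log ratio is not of the same sign, so that the
    two differ by more than [2 a]; one of the two soft maxima accounts for half
    of this. *)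
Lemma wrong_prediction_deviation s0 H (D : probability (X * bool)%type R)
    m (S : m.-tuple (X * bool)) eta a x : 0 <= a ->
  prediction s0 H S eta (2 * a) x <> 0 ->
  prediction s0 H S eta (2 * a) x <> sign s0 (true_log_ratio H D eta x) ->
  (forall c, 0 < size (voters H x c))%N /\
  exists c, a < `|soft_max (voters H x c) eta (fun h => - empirical_error S h) -
                  soft_max (voters H x c) eta (fun h => - true_error D h)|.
Proof.
move=> a0; rewrite /prediction /empirical_log_ratio /true_log_ratio.
case: ifPn => // big_l _ sgn.
have [vot|/existsNP[c /negP]] :=
  pselect (forall c, 0 < size (voters H x c))%N; last first.
  rewrite lt0n negbK size_eq0 => /eqP Hc.
  have [eql inf] := log_ratio_unanimous H c (empirical_error S) (true_error D)
    eta x Hc.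
  by case: sgn; rewrite eql.
split=> //; move: big_l sgn; rewrite !log_ratioE//=.
set up := soft_max _ _ _; set um := soft_max _ _ _.
set vp := soft_max _ _ _; set vm := soft_max _ _ _.
rewrite lte_fin /sign !lte_fin => big_l sgn.
have far : 2 * a < `|(up - um) - (vp - vm)|.
  move: big_l; rewrite !ltr_normr => /orP[l_pos|l_neg]; apply/orP.
    have vpm : vp - vm <= 0.
      rewrite leNgt; apply/negP => v0; apply: sgn.
      by rewrite v0 ifT//; lra.
    by left; lra.
  have vpm : 0 <= vp - vm.
    rewrite leNgt; apply/negP => v0; apply: sgn.
    by rewrite v0 !ltNge (ltW v0)/= ifF ?ifT//=; lra.
  by right; lra.
have [big_p|small_p] := ltP a `|up - vp|; first by exists true.
exists false; have -> : um - vm = (up - vp) - ((up - um) - (vp - vm)) by ring.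
rewrite distrC; apply: lt_le_trans (lerB_dist _ _); lra.
Qed.

End voters.

(** * Size of the grid *)

Section constants.
Context {R : realType}.
Variables (m N : nat) (delta : R).
Hypotheses (m_gt0 : (0 < m)%N) (N_ge2 : (2 <= N)%N).
Hypotheses (delta_gt0 : 0 < delta) (delta_lt1 : delta < 1).

(** The threshold is [2 * (margin + eta / (2 * m))]. *)
Definition margin : R :=
  Num.sqrt (2 / m%:R * ln (16 * m%:R * ln N%:R / delta ^+ 2)).

(** Each grid point contributes four events of probability at most
    [delta ^+ 2 / (16 * m * ln N)], so that this many grid points keep the total
    below [delta ^+ 2]. *)
Definition grid_size : nat := Num.truncn (4 * m%:R * ln N%:R : R).

Let m1 : 1 <= m%:R :> R. Proof. by rewrite ler1n. Qed.

Let lnN_ge : 1 / 2 <= ln N%:R :> R.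
Proof.
have N0 : 0 < N%:R :> R by rewrite ltr0n; exact: leq_trans N_ge2.
have Ninv : (N%:R : R)^-1 <= 1 / 2.
  by rewrite div1r lef_pV2 ?posrE// ler_nat.
have := expR_ge1Dx (- ln N%:R : R); rewrite expRN lnK ?posrE//; lra.
Qed.

Let Y : R := 4 * m%:R * ln N%:R.
Let Y_ge2 : 2 <= Y.
Proof. by have := m1; have := lnN_ge; rewrite /Y; nra. Qed.

Let A : R := 16 * m%:R * ln N%:R / delta ^+ 2.
Let AE : A = 4 * Y / delta ^+ 2.
Proof. by rewrite /A /Y; congr (_ / _); ring. Qed.

Let A_ge8 : 8 <= A.
Proof.
rewrite AE ler_pdivlMr ?exprn_gt0//.
have d2 : delta ^+ 2 <= 1 by rewrite expr_le1 ?ltW.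
have := Y_ge2; lra.
Qed.

Let L_ge : 1 / 2 <= ln A.
Proof.
have A0 : 0 < A by have := A_ge8; lra.
have Ainv : A^-1 <= 1 / 2.
  by rewrite div1r lef_pV2 ?posrE//; have := A_ge8; lra.
have := expR_ge1Dx (- ln A); rewrite expRN lnK ?posrE//; lra.
Qed.

Lemma grid_size_itv : (grid_size%:R : R) <= Y < grid_size%:R + 1.
Proof. by rewrite natr1; apply: truncn_itv; have := Y_ge2; rewrite /Y; lra. Qed.

Lemma grid_size_gt0 : (0 < grid_size)%N.
Proof.
by rewrite truncn_gt0; have := Y_ge2; rewrite /Y; lra.
Qed.

Lemma margin_ge0 : 0 <= margin. Proof. exact: sqrtr_ge0. Qed.

Lemma margin_sqr : m%:R * margin ^+ 2 = 2 * ln A.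
Proof.
rewrite sqr_sqrtr -/A; first by field; rewrite gt_eqF// ltr0n.
by rewrite mulr_ge0 ?divr_ge0//; have := L_ge; lra.
Qed.

(** What rounding costs. The deviation controlled at grid point [s] is
    [3/4 margin + s / 4m], out of an available [margin + eta / 2m], and the
    right-hand side is a lower bound for the difference, as [s <= eta] and
    [1 <= eta]. *)
Lemma grid_error_le : ln N%:R / grid_size%:R <= margin / 4 + 1 / (4 * m%:R) :> R.
Proof.
have g0 : 0 < grid_size%:R :> R by rewrite ltr0n grid_size_gt0.
have m0 : 0 < m%:R :> R by rewrite ltr0n.
have step : ln N%:R / grid_size%:R <= 1 / (2 * m%:R) :> R.
  rewrite ler_pdivrMr// mulrAC ler_pdivlMr ?mulr_gt0// mul1r.
  have /andP[_] := grid_size_itv; have := Y_ge2; rewrite /Y; lra.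
apply: (le_trans step).
have inv_margin : 1 / m%:R <= margin.
  rewrite ler_pdivrMr// -(@expr_ge1 _ 2) ?mulr_ge0 ?margin_ge0//.
  have -> : (margin * m%:R) ^+ 2 = m%:R * (m%:R * margin ^+ 2) by ring.
  by rewrite margin_sqr; have := L_ge; have := m1; nra.
have -> : 1 / (2 * m%:R) = 1 / m%:R / 2 :> R by field; rewrite gt_eqF.
have -> : 1 / (4 * m%:R) = 1 / m%:R / 4 :> R by field; rewrite gt_eqF.
by lra.
Qed.

(** The factor 4 counts the two classes of voters and the two tails. The
    exponent is 9/8 of the logarithm in [margin], and one times that logarithm
    is enough. *)
Lemma grid_union_bound :
  (grid_size * 4)%N%:R * expR (- (m%:R * (3 / 4 * margin) ^+ 2)) <= delta ^+ 2.
Proof.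
have A0 : 0 < A by have := A_ge8; lra.
have d0 : 0 < delta ^+ 2 by rewrite exprn_gt0.
apply: (@le_trans _ _ ((grid_size * 4)%N%:R * A^-1)).
  rewrite ler_wpM2l// -[A]lnK ?posrE// -expRN ler_expR lerN2.
  rewrite exprMn mulrCA margin_sqr; have := L_ge; lra.
rewrite ler_pdivrMr// AE mulrC divfK ?gt_eqF// natrM mulrC.
by have /andP[? _] := grid_size_itv; lra.
Qed.

End constants.

(** * The bound at a fixed point, and the theorem *)

Section concentration.
Context {d : measure_display} {X : measurableType d} {R : realType}.
Variables (D : probability (X * bool)%type R) (m : nat).
Hypothesis m_gt0 : (0 < m)%N.

(** With [t = 2 m lam + s] the exponent [t^2 / 4m - t (lam + s / 4m)] equals
    [- t lam / 2], at most [- m lam^2]. For a deviation [lam] alone the best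
    choice is [t = 2 m lam], but comparing exponential means needs [s <= t]; the
    additional [s / 4m] in the deviation pays for the summand [s]. *)
Lemma soft_max_tail (r : seq (X -> bool)) (s t lam : R) (sg : bool) :
  (0 < size r)%N -> {in r, forall h, measurable_fun [set: X] h} ->
  0 < s -> 0 <= lam ->
  t = 2 * m%:R * lam + s ->
  (power_probability D m [set S | (expR (t * (lam + s / (4 * m%:R))) <=
      exp_deviation D m r (gibbs r s (fun h => - true_error D h))
        ((-1) ^+ sg * t) S)%R] <= (expR (- (m%:R * lam ^+ 2)))%:E)%E.
Proof.
move=> r0 mr s0 lam0 tE; have m0 : 0 < m%:R :> R by rewrite ltr0n.
apply: le_trans (exp_deviation_tail _ _ _ _ _ _ m_gt0 (expR_gt0 _) mr
  (gibbs_ge0 _ _ _) (sum_gibbs _ _ _ r0)) _.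
rewrite lee_fin -expRB ler_expR exprMn sqrr_sign mul1r.
have -> : t ^+ 2 / (4 * m%:R) - t * (lam + s / (4 * m%:R)) =
    - (m%:R * lam ^+ 2) - s * lam / 2 by rewrite tE; field; rewrite gt_eqF.
by rewrite gerDl oppr_le0 divr_ge0// mulr_ge0// ltW.
Qed.

(** Union bound over the grid, the two classes of voters and the two tails; on
    the complement, the deviations at all [eta >= 1] are below half of the
    threshold. *)
Lemma pointwise_bound (s0 : int) (H : {fset X -> bool}) (delta : R) (x : X)
    (A : set (m.-tuple (X * bool))) :
  (forall h, h \in H -> measurable_fun [set: X] h) -> (2 <= #|` H|)%N ->
  0 < delta -> delta < 1 -> measurable A ->
  (forall S, A S -> exists2 eta : R, 1 <= eta &
     let p := prediction s0 H S eta (threshold #|` H| m delta eta) x in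
     p <> 0 /\ p <> sign s0 (true_log_ratio H D eta x)) ->
  (power_probability D m A <= (delta ^+ 2)%:E)%E.
Proof.
move=> mH H2 d0 d1 mA Abad; have m0 : 0 < m%:R :> R by rewrite ltr0n.
set N := #|` H| in H2 Abad.
pose lam0 : R := margin m N delta.
have lam0_ge0 : 0 <= lam0 by exact: margin_ge0.
have thresholdE eta : threshold N m delta eta = 2 * (lam0 + eta / (2 * m%:R)).
  by rewrite /threshold -/(margin m N delta) -/lam0; field; rewrite gt_eqF.
have Adev S : A S -> exists2 eta : R, 1 <= eta &
    (forall c, 0 < size (voters H x c))%N /\
    exists c, lam0 + eta / (2 * m%:R) <
      `|soft_max (voters H x c) eta (fun h => - empirical_error S h) -
        soft_max (voters H x c) eta (fun h => - true_error D h)|.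
  move=> /Abad[eta eta1]; rewrite thresholdE => -[p0 psign]; exists eta => //.
  apply: wrong_prediction_deviation p0 psign.
  by rewrite addr_ge0// divr_ge0 ?mulr_ge0//; lra.
have [vot|novot] := pselect (forall c, 0 < size (voters H x c))%N; last first.
  rewrite (_ : A = set0) ?measure0 ?lee_fin ?sqr_ge0//.
  by apply/seteqP; split=> // S /Adev[eta _ []].
have mr c : {in voters H x c, forall h, measurable_fun [set: X] h}.
  by move=> h /voters_sub/mH.
pose n := @grid_size R m N.
have n0 : (0 < n)%N by exact: grid_size_gt0.
pose lam := 3 / 4 * lam0.
have lam_ge0 : 0 <= lam by rewrite /lam; lra.
pose s (j : 'I_n) : R := grid_point R n j.
pose t j : R := 2 * m%:R * lam + s j.
have s_gt0 j : 0 < s j by rewrite divr_gt0// ltr0n.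
pose F (k : 'I_n * (bool * bool)) :=
  [set S | (expR (t k.1 * (lam + s k.1 / (4 * m%:R))) <=
      exp_deviation D m (voters H x k.2.1)
        (gibbs (voters H x k.2.1) (s k.1) (fun h => - true_error D h))
        ((-1) ^+ k.2.2 * t k.1) S)%R].
have mF k : measurable (F k).
  rewrite -[F k]setTI; apply: measurable_fun_le => //.
  by apply: measurable_exp_deviation; exact: mr.
have PF k : (power_probability D m (F k) <= (expR (- (m%:R * lam ^+ 2)))%:E)%E.
  exact: soft_max_tail.
suff AF : A `<=` \bigcup_k F k.
  apply: le_trans (measure_finite_union_le _ _ _ _ _ mF mA AF PF) _.
  rewrite lee_fin !card_prod card_ord card_bool.
  exact: grid_union_bound.
move=> S /Adev[eta eta1 [_ [c far]]].
have [j sj_eta gap] := temperature_grid n eta n0 eta1; rewrite -/(s j) in sj_eta gap.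
apply: contrapT => notF.
have small (sg : bool) : exp_deviation D m (voters H x c)
    (gibbs (voters H x c) (s j) (fun h => - true_error D h))
    ((-1) ^+ sg * t j) S <= expR (t j * (lam + s j / (4 * m%:R))).
  rewrite leNgt; apply/negP => big; apply: notF.
  by exists (j, (c, sg)) => //=; exact: ltW.
have near : `|soft_max (voters H x c) (s j) (fun h => - empirical_error S h) -
    soft_max (voters H x c) (s j) (fun h => - true_error D h)| <=
    lam + s j / (4 * m%:R).
  apply: (@soft_max_dist _ _ _ _ (t j)) => //.
  - by rewrite s_gt0 /t lerDr !mulr_ge0// ltW.
  - apply: le_trans (small true); rewrite /exp_deviation le_eqVlt; apply/orP; left.
    by apply/eqP/eq_bigr => h _; congr (_ * expR _); rewrite expr1; ring.
  - apply: le_trans (small false); rewrite /exp_deviation le_eqVlt; apply/orP; left.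
    by apply/eqP/eq_bigr => h _; congr (_ * expR _); rewrite expr0; ring.
have := soft_max_dist_transfer _ eta _ _ _ _ (vot c) sj_eta near.
have K0 : (0 < (size (voters H x c))%:R :> R) by rewrite ltr0n.
have lnK : 0 <= ln (size (voters H x c))%:R :> R by rewrite ln_ge0// ler1n.
have gapN : ln (size (voters H x c))%:R * ((s j)^-1 - eta^-1) <= ln N%:R / n%:R :> R.
  apply: (@le_trans _ _ (ln (size (voters H x c))%:R / n%:R)); first exact: ler_wpM2l.
  rewrite ler_wpM2r// ler_ln ?posrE// ?ler_nat ?size_voters_le//.
  by rewrite ltr0n; exact: leq_trans H2.
have gridN := grid_error_le _ _ _ m_gt0 H2 d0 d1; rewrite -/n -/N -/lam0 in gridN.
have sj4 : s j / (4 * m%:R) <= eta / (4 * m%:R).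
  by rewrite ler_wpM2r ?invr_ge0 ?mulr_ge0//; case/andP: sj_eta.
have one4 : 1 / (4 * m%:R) <= eta / (4 * m%:R).
  by rewrite ler_wpM2r ?invr_ge0 ?mulr_ge0.
have half : eta / (2 * m%:R) = eta / (4 * m%:R) + eta / (4 * m%:R).
  by field; rewrite gt_eqF.
move: far; rewrite half /lam; lra.
Qed.

End concentration.

(** Whether a pair (example, sample) errs for some [eta] depends only on the
    finitely many booleans [h x] and [h x_i != y_i], so the uncountable quantifier
    over [eta] does no harm. *)
Lemma measurable_wrong_pairs {d : measure_display} {X : measurableType d}
    {R : realType} (D : probability (X * bool)%type R) (s0 : int)
    (H : {fset X -> bool}) m (Delta : R -> R) :
  (forall h, h \in H -> measurable_fun [set: X] h) ->
  measurable [set zS : (X * bool) * m.-tuple (X * bool) |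
    exists2 eta : R, 1 <= eta & wrong_predictions s0 H D zS.2 eta (Delta eta) zS.1].
Proof.
move=> mH.
have mloss (h : X -> bool) : h \in H ->
    measurable_fun setT (fun z : X * bool => h z.1 != z.2).
  move=> hH; apply: (@measurable_fun_bool _ _ _ _ true); rewrite setTI.
  exact: measurable_loss (mH _ hH).
pose f (k : H + H * 'I_m) (zS : (X * bool) * m.-tuple (X * bool)) : bool :=
  match k with
  | inl h => (val h) zS.1.1
  | inr (h, i) => (val h) (tnth zS.2 i).1 != (tnth zS.2 i).2
  end.
apply: (@measurable_features _ _ _ f) => [[h|[h i]]|[z S] [z' S'] E].
- rewrite /f; apply: (measurableT_comp (mH _ (valP h))).
  exact: (measurableT_comp measurable_fst measurable_fst).
- rewrite /f; apply: (measurableT_comp (mloss _ (valP h))).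
  exact: (measurableT_comp (measurable_tnth i) measurable_snd).
have Ex : {in H, forall h : X -> bool, h z.1 = h z'.1}.
  by move=> h hH; exact: (E (inl [` hH]%fset)).
have ES : {in H, empirical_error (R := R) S =1 empirical_error S'}.
  move=> h hH; congr (_ * _); apply: eq_bigr => i _.
  have El : (h (tnth S i).1 != (tnth S i).2) = (h (tnth S' i).1 != (tnth S' i).2).
    exact: E (inr ([` hH]%fset, i)).
  by rewrite El.
move=> [eta eta1 /= W]; exists eta => //=; move: W.
rewrite /wrong_predictions /prediction /true_log_ratio /empirical_log_ratio /=.
by rewrite (eq_log_ratio _ Ex ES) (eq_log_ratio _ Ex (fun _ _ => erefl)).
Qed.

Theorem theorem6 (R : realType) (d : measure_display) (X : measurableType d)
    (H : {fset X -> bool})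
    (mH : forall h : X -> bool, h \in H -> measurable_fun [set: X] h)
    (H_ge2 : (2 <= #|` H|)%N)
    (D : probability (X * bool)%type R)
    (m : nat) (m_ge1 : (1 <= m)%N)
    (s0 : int) (hs0 : s0 \in [:: -1; 0; 1])
    (delta : R) (delta_gt0 : 0 < delta)
    (hdelta : delta ^+ 2 <= 16 * m%:R * ln (#|` H|)%:R) :
  ((1 - delta)%:E <= power_probability D m
     [set S : m.-tuple (X * bool) |
       forall eta : R, (1 <= eta)%R ->
         D (wrong_predictions s0 H D S eta (threshold #|` H| m delta eta))
           <= delta%:E])%E.
Proof.
have [d1|d1] := leP 1 delta.
  by apply: (@le_trans _ _ 0%E); rewrite ?measure_ge0// lee_fin subr_le0.
set good := [set S | _].
pose thr : R -> R := threshold #|` H| m delta.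
pose A := [set zS : (X * bool) * m.-tuple (X * bool) |
    exists2 eta : R, 1 <= eta & wrong_predictions s0 H D zS.2 eta (thr eta) zS.1].
have mA : measurable A by exact: measurable_wrong_pairs.
have mgood : measurable good by exact: measurable_good_samples.
pose bad : set (m.-tuple (X * bool)) := [set S | (delta%:E <= D (ysection A S))%E].
have Pbad : (power_probability D m bad <= delta%:E)%E.
  apply: fubini_markov => // z.
  apply: (pointwise_bound D m m_ge1 s0 H delta z.1) => //.
    exact: measurable_xsection.
  move=> S; rewrite /xsection /= inE => -[eta eta1 /= [p0 psign]].
  by exists eta.
have mbad : measurable bad.
  rewrite -[bad]setTI; apply: emeasurable_fun_c_infty => //.
  exact: measurable_fun_ysection.
have bad_good : ~` bad `<=` good.
  move=> S /negP; rewrite -ltNge => small eta eta1; apply: le_trans (ltW small).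
  apply: le_measure; rewrite ?inE.
  - exact: measurable_wrong_predictions.
  - exact: measurable_ysection.
  - by move=> z wz; rewrite /ysection /= inE; exists eta.
apply: (@le_trans _ _ (power_probability D m (~` bad))); last first.
  by apply: le_measure => //; rewrite inE//; exact: measurableC.
rewrite probability_setC// EFinB leeB//.
Qed.
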